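(* Let $1<q<\infty$ and $q^*=q/(q-1)$. Then $\pi_{2q/(q+2),q}/2^{2/q+1}=\pi_{q/2,q}/2$ (as elements of $(0,\infty]$), and for all $x\in[0,\pi_{2q/(q+2),q}/2^{2/q+1})=[0,\pi_{q/2,q}/2)$, $$\sinh_{2,q}(2^{2/q}x)=2^{2/q}\sinh_{q^*,q}x\,\cosh_{q^*,q}^{q^*-1}x,$$ $$\cosh_{2,q}(2^{2/q}x)=\cosh_{q^*,q}^{q^*}x+\sinh_{q^*,q}^q x.$$ Moreover, for the same $x$, $$\sin_{2q/(q+2),q}(2^{2/q}x)=\frac{2^{2/q}\sin_{q/2,q}x}{(1+\sin_{q/2,q}^q x)^{2/q}},$$ $$\cos_{2q/(q+2),q}(2^{2/q}x)=\left(\frac{1-\sin_{q/2,q}^q x}{1+\sin_{q/2,q}^q x}\right)^{2/q+1}.$$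
   Context: For $1<q<\infty$ and $q/(q+1)<p<\infty$ (note that $p\le 1$ is allowed): Let $F_{p,q}(y)=\int_0^y \frac{dt}{(1-t^q)^{1/p}}$ for $y\in[0,1)$ and $\pi_{p,q}=2\int_0^1\frac{dt}{(1-t^q)^{1/p}}\in(0,\infty]$, which is finite for $p>1$ and equals $\infty$ for $p\le 1$. The function $\sin_{p,q}:[0,\pi_{p,q}/2)\to[0,1)$ is the inverse of $F_{p,q}$, and $\cos_{p,q}x=\frac{d}{dx}\sin_{p,q}x$ (one-sided derivative at $x=0$). Let $G_{p,q}(y)=\int_0^y \frac{dt}{(1+t^q)^{1/p}}$ for $y\in[0,\infty)$. With $r=r(p)$ defined by $\frac1p+\frac1r=1+\frac1q$ (so that $r>q/(q+1)$ as well), $\sinh_{p,q}:[0,\pi_{r,q}/2)\to[0,\infty)$ is the inverse of $G_{p,q}$ (one has $\lim_{y\to\infty}G_{p,q}(y)=\pi_{r,q}/2$), and $\cosh_{p,q}x=\frac{d}{dx}\sinh_{p,q}x$ (one-sided derivative at $x=0$). The notation $\sin_{p,q}^a x$ means $(\sin_{p,q}x)^a$, and similarly for the other functions. *)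

(* Defs.v *)
From HB Require Import structures.
From mathcomp Require Export all_boot all_order all_algebra.
From mathcomp Require Export all_classical all_reals all_analysis.
Export Order.TTheory GRing.Theory Num.Theory.
Export numFieldNormedType.Exports.

Set Implicit Arguments.
Unset Strict Implicit.
Unset Printing Implicit Defensive.

Local Open Scope classical_set_scope.
Local Open Scope ring_scope.

Section generalized_trigonometric_functions.
Context {R : realType}.
Implicit Types (f : R -> R) (p q x y : R).

Let mu := @lebesgue_measure R.

Definition Fint p q y : R :=
  \int[mu]_(t in `[0, y]) ((1 - t `^ q) `^ p^-1)^-1.

Definition Gint p q y : R :=
  \int[mu]_(t in `[0, y]) ((1 + t `^ q) `^ p^-1)^-1.

(* Extended-real valued: it is +oo when the integral diverges (p <= 1). *)
Definition pipq p q : \bar R :=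
  (2%:E * \int[mu]_(t in `[0%R, 1%R[) (((1 - t `^ q) `^ p^-1)^-1)%:E)%E.

(* The generalized functions are defined on intervals [0, b[; the derivative
   is one-sided at the left endpoint. *)
Definition deriv_from0 f x : R :=
  if x == 0 then lim (h^-1 * (f h - f 0) @[h --> 0^'+]) else derive1 f x.

(* 'pinv_ d A f inverts the restriction of f to A on its image f @` A; here
   this image is [0, pi_{p,q} / 2[. *)
Definition sinpq p q : R -> R := 'pinv_(fun=> 0) `[0, 1[ (Fint p q).

Definition cospq p q : R -> R := deriv_from0 (sinpq p q).

(* The image of [0, +oo[ under Gint p q is [0, pi_{r,q} / 2[, where
   1 / p + 1 / r = 1 + 1 / q. *)
Definition sinhpq p q : R -> R := 'pinv_(fun=> 0) `[0, +oo[ (Gint p q).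

Definition coshpq p q : R -> R := deriv_from0 (sinhpq p q).

End generalized_trigonometric_functions.

(* Main.v *)
(* Both pairs of identities come from changes of variable of the form
   z |-> c z (1 + z^q)^b. Put u = z^q and c = 2^(2/q). For phi = c z (1 + u)^(1/q)
   one has 1 + phi^q = (1 + 2 u)^2, which gives G_{2,q} o phi = c G_{q*,q}. For
   psi = c z (1 + u)^(-2/q) one has 1 - psi^q = ((1 - u) / (1 + u))^2, which gives
   F_{2q/(q+2),q} o psi = c F_{q/2,q}; as psi maps [0, 1[ onto itself, this also
   gives the identity between the two values of pi. Finally
   theta = z (1 + u)^(-1/q) maps [0, +oo[ onto [0, 1[ and
   F_{q/2,q} o theta = G_{q*,q}, so that every x < pi_{q/2,q} / 2 is a value of
   G_{q*,q}. *)
Require Import Defs.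
From mathcomp Require Import ring lra.

Set Implicit Arguments.
Unset Strict Implicit.
Unset Printing Implicit Defensive.

Local Open Scope classical_set_scope.
Local Open Scope ring_scope.

(** * Primitives of positive continuous functions and derivatives of their inverses *)

Section inverse_of_primitive.
Context {R : realType}.
Notation mu := (@lebesgue_measure R).
Implicit Types (k : R -> R) (U : set R) (x y z h : R).

(** Being open and closed downwards, [U] contains a neighbourhood of 0 and every negative real;
    continuity and positivity of [k] on the left of 0 make it possible to continue the primitive
    past the endpoint. *)
Definition integrand_on k U := [/\ open U, forall x y, x <= y -> U y -> U x,
  U 0, forall x, U x -> {for x, continuous k} & forall x, U x -> 0 < k x].

Variables (k : R -> R) (U : set R).
Hypothesis kU : integrand_on k U.

Let oU : open U. Proof. by case: kU. Qed.
Let dU x y : x <= y -> U y -> U x. Proof. by case: kU => _ + _ _ _; exact. Qed.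
Let U0 : U 0. Proof. by case: kU. Qed.
Let ck x : U x -> {for x, continuous k}.
Proof. by case: kU => _ _ _ + _; exact. Qed.
Let k_gt0 x : U x -> 0 < k x. Proof. by case: kU => _ _ _ _; exact. Qed.

Let primitive (y : R) := \int[mu]_(t in `[0, y]) k t.

(* [ext] agrees with the primitive on the right of 0 and continues it to the left
   of 0, so that the endpoint 0 becomes an interior point. *)
Let ext (y : R) := \int[mu]_(t in `[-1, y]) k t - \int[mu]_(t in `[-1, 0]) k t.

Lemma integrable_primitive a y : U y -> mu.-integrable `[a, y] (EFin \o k).
Proof.
move=> Uy; apply: continuous_compact_integrable; first exact: segment_compact.
apply/continuous_in_subspaceT => x; rewrite inE/= in_itv/= => /andP[_ xy].
by apply: ck; exact: dU Uy.
Qed.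

Let is_derive_ext y : -1 < y -> U y -> is_derive y (1 : R) ext (k y).
Proof.
move=> y1 Uy.
have [e /= e0 He] : \forall z \near y, U z by apply: open_nbhs_nbhs.
(* The fundamental theorem is applied on an interval to which [y] is interior, which requires a
   point of [U] to the right of [y]. *)
have Uu : U (y + e / 2).
  apply: He => /=; rewrite opprD addNKr normrN gtr0_norm ?divr_gt0//.
  by rewrite ltr_pdivrMr// ltr_pMr// ltr1n.
have yu : y < y + e / 2 by rewrite ltrDl divr_gt0.
have [d1 d2] := continuous_FTC1_closed yu (integrable_primitive (-1) Uu) y1 (ck Uy).
have H : is_derive y (1 : R) (fun y => \int[mu]_(t in `[-1, y]) k t) (k y).
  by split; [exact: d1|rewrite -derive1E; exact: d2].
rewrite -[k y]subr0; exact: is_deriveB.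
Qed.

Let extE y : 0 <= y -> U y -> ext y = primitive y.
Proof.
move=> y0 Uy; rewrite /ext (Rintegral_itvB (integrable_primitive (-1) Uy)).
- rewrite Rintegral_itv_obnd_cbnd//.
  apply: integrableS (integrable_primitive 0 Uy) => //.
  by apply: subset_itvr; rewrite bnd_simp.
- by rewrite bnd_simp lerN10.
- by rewrite bnd_simp.
Qed.

Let ext_cont y : -1 < y -> U y -> {for y, continuous ext}.
Proof.
move=> y1 Uy; apply/differentiable_continuous/derivable1_diffP.
by have [] := is_derive_ext y1 Uy.
Qed.

Let ext_lt x y : -1 < x -> x < y -> U y -> ext x < ext y.
Proof.
move=> x1 xy Uy.
have inU z : z <= y -> U z by move=> zy; exact: dU Uy.
have [||c] := @MVT R ext k x y xy.
- move=> z /[!in_itv]/= /andP[xz zy].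
  by apply: is_derive_ext; [exact: lt_trans xz|exact/inU/ltW].
- apply/continuous_in_subspaceT => z; rewrite inE/= in_itv/= => /andP[xz zy].
  by apply: ext_cont; [exact: lt_le_trans xz|exact/inU].
- rewrite in_itv/= => /andP[xc cy] e.
  by rewrite -subr_gt0 e mulr_gt0 ?subr_gt0// k_gt0//; exact/inU/ltW.
Qed.

Lemma primitive_at0 : primitive 0 = 0.
Proof. by rewrite -extE// /ext subrr. Qed.

Lemma primitive_lt x y : 0 <= x -> x < y -> U y -> primitive x < primitive y.
Proof.
move=> x0 xy Uy; have y0 : 0 <= y := le_trans x0 (ltW xy).
rewrite -!extE//; last exact: dU (ltW xy) Uy.
by apply: ext_lt => //; exact: lt_le_trans x0.
Qed.

Lemma primitive_le x y : 0 <= x -> x <= y -> U y -> primitive x <= primitive y.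
Proof.
move=> x0; rewrite le_eqVlt => /predU1P[->//|xy Uy].
by rewrite ltW// primitive_lt.
Qed.

Lemma primitive_inj x y : 0 <= x -> 0 <= y -> U x -> U y ->
  primitive x = primitive y -> x = y.
Proof.
move=> x0 y0 Ux Uy e; case: (ltgtP x y) => // xy.
- by have := primitive_lt x0 xy Uy; rewrite e ltxx.
- by have := primitive_lt y0 xy Ux; rewrite e ltxx.
Qed.

Lemma is_derive_primitive y : 0 < y -> U y ->
  is_derive y (1 : R) primitive (k y).
Proof.
move=> y0 Uy; apply: near_eq_is_derive (is_derive_ext _ Uy); last first.
  exact: lt_trans y0.
near=> z; apply: extE.
  by apply/ltW; near: z; exact: lt_nbhsr.
by near: z; apply: open_nbhs_nbhs.
Unshelve. all: by end_near. Qed.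

(** For negative [y] the interval of integration is empty, so [primitive] vanishes there and agrees
    on [U] with [ext] composed with [m z = max 0 z]. *)
Lemma continuous_primitive y : U y -> {for y, continuous primitive}.
Proof.
move=> Uy.
pose m (z : R) : R := Num.max 0 z.
have Um z : U z -> U (m z) by rewrite /m maxEle; case: ifP.
have m0 z : 0 <= m z by rewrite /m le_max lexx.
have cm : {for y, continuous (ext \o m)}.
  apply: continuous_comp; last first.
    by apply: ext_cont; [exact: lt_le_trans (m0 _)|exact: Um].
  by apply: continuous_max; [exact: cst_continuous|exact: cvg_id].
have E z : U z -> (ext \o m) z = primitive z.
  move=> Uz; rewrite /= extE//; last exact: Um.
  rewrite /m; have [//|z0] := leP 0 z.
  rewrite primitive_at0 /primitive set_itv_ge ?Rintegral_set0//.
  by rewrite bnd_simp -ltNge.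
move: cm; rewrite /prop_for /continuous_at (E _ Uy); apply: cvg_trans.
apply: near_eq_cvg.
have /= := open_nbhs_nbhs (conj oU Uy); exact: filterS.
Qed.

Lemma primitive_IVT y x : 0 <= y -> U y -> 0 <= x <= primitive y ->
  exists z, [/\ 0 <= z, U z & primitive z = x].
Proof.
move=> y0 Uy /andP[x0 xy].
have [||z] := @IVT R primitive 0 y x y0.
- apply/continuous_in_subspaceT => z; rewrite inE/= in_itv/= => /andP[_ zy].
  by apply: continuous_primitive; exact: dU Uy.
- by rewrite primitive_at0 ge_min x0 le_max xy orbT.
- rewrite in_itv/= => /andP[z0 zy] <-; exists z; split => //; exact: dU Uy.
Qed.

Variable A : set R.
Hypothesis AE : A = [set y | 0 <= y /\ U y].

Let inv := 'pinv_(fun=> 0) A primitive.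

Lemma primitiveK y : 0 <= y -> U y -> inv (primitive y) = y.
Proof.
move=> y0 Uy; apply: pinvKV; last by rewrite inE AE.
move=> x z; rewrite !inE AE/= => -[x0 Ux] [z0 Uz]; exact: primitive_inj.
Qed.

(* Left of 0 the inverse is completed by that of [ext], which makes it
   two-sided differentiable at 0. *)
Let ext_inv h : R :=
  if h < 0 then 'pinv_(fun=> 0) [set y | -1 < y /\ U y] ext h else inv h.

Let is_derive_ext_inv y : 0 <= y -> U y ->
  is_derive (primitive y) (1 : R) ext_inv (k y)^-1.
Proof.
move=> y0 Uy; rewrite -(extE y0 Uy).
have ext0 : ext 0 = 0 by rewrite /ext subrr.
have y1 : -1 < y by exact: lt_le_trans y0.
apply: is_derive_inverse (is_derive_ext y1 Uy) _.
- near=> z.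
  have z1 : -1 < z by near: z; exact: lt_nbhsr.
  have Uz : U z by near: z; apply: open_nbhs_nbhs.
  rewrite /ext_inv; have [z0|z0] := leP 0 z.
    rewrite extE// ltNge -{1}primitive_at0 primitive_le//=.
    exact: primitiveK.
  (* Here [z < 0], hence [ext z < ext 0 = 0], which selects the other branch of [ext_inv]. *)
  rewrite -{1}ext0 ext_lt//; apply: pinvKV; last by rewrite inE/=.
  move=> a b; rewrite !inE/= => -[a1 Ua] [b1 Ub] e; case: (ltgtP a b) => // ab.
  + by have := ext_lt a1 ab Ub; rewrite e ltxx.
  + by have := ext_lt b1 ab Ua; rewrite e ltxx.
- near=> z; apply: ext_cont.
    by near: z; exact: lt_nbhsr.
  by near: z; apply: open_nbhs_nbhs.
- by rewrite gt_eqF// k_gt0.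
Unshelve. all: by end_near. Qed.

Lemma deriv_from0_inv y : 0 <= y -> U y ->
  deriv_from0 inv (primitive y) = (k y)^-1.
Proof.
move=> y0 Uy; rewrite /deriv_from0; case: ifPn => [/eqP e|].
  have {}e : y = 0 by apply: primitive_inj; rewrite // primitive_at0.
  have := is_derive_ext_inv y0 Uy; rewrite e primitive_at0 => -[d1 d2].
  rewrite -d2; apply: cvg_lim => //.
  (* The two-sided limit for [ext_inv] restricts to the right of 0, where [ext_inv] is [inv]. *)
  apply: cvg_trans (cvg_dnbhs_at_right d1).
  apply: near_eq_cvg; near=> h.
  have h0 : 0 < h by near: h; exact: nbhs_right_gt.
  by rewrite /ext_inv /= !addr0 [h *: _]mulr1 ltxx ltNge ltW.
move=> p0.
have {}p0 : 0 < primitive y.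
  by rewrite lt_def p0 -{1}primitive_at0 primitive_le.
have [_ <-] := is_derive_ext_inv y0 Uy.
rewrite derive1E; apply: near_eq_derive; near=> h.
rewrite /ext_inv ltNge ltW//; near: h; exact: lt_nbhsr.
Unshelve. all: by end_near. Qed.

End inverse_of_primitive.

(** * Change of variable by comparison of derivatives *)

Section substitution.
Context {R : realType}.
Notation mu := (@lebesgue_measure R).

(** The difference [D] of the two sides, as a function of the endpoint, has derivative 0 at positive
    points and is right-continuous at 0, so the mean value theorem gives [D y = D 0 = 0]. At 0 only
    a right limit of [phi] enters, because powers are differentiated at positive points. *)
Lemma primitive_substitution (k1 k2 : R -> R) (U1 U2 : set R)
    (phi dphi : R -> R) (c y : R) :
  integrand_on k1 U1 -> integrand_on k2 U2 ->
  phi 0 = 0 -> phi z @[z --> 0^'+] --> 0 ->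
  (forall z : R, 0 < z -> U2 z ->
    [/\ 0 < phi z, U1 (phi z), is_derive z (1 : R) phi (dphi z)
      & k1 (phi z) * dphi z = c * k2 z]) ->
  0 <= y -> U2 y ->
  \int[mu]_(t in `[0, phi y]) k1 t = c * \int[mu]_(t in `[0, y]) k2 t.
Proof.
move=> kU1 kU2 phi0 cphi H.
rewrite le_eqVlt => /predU1P[<- _|y0 Uy].
  by rewrite phi0 !set_itv1 !Rintegral_set1 mulr0.
pose P1 (x : R) := \int[mu]_(t in `[0, x]) k1 t.
pose P2 (x : R) := \int[mu]_(t in `[0, x]) k2 t.
pose D (z : R) := P1 (phi z) - c * P2 z.
have dD (z : R) : 0 < z -> U2 z -> is_derive z (1 : R) D 0.
  move=> z0 Uz; have [p0 Up dp e] := H z z0 Uz.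
  have h1 := is_derive1_comp (is_derive_primitive kU1 p0 Up) dp.
  have h2 := is_deriveZ c (is_derive_primitive kU2 z0 Uz).
  by have := is_deriveB h1 h2; rewrite e [_ *: _]/GRing.scale/= subrr.
have cD (z : R) : 0 < z -> U2 z -> {for z, continuous D}.
  move=> z0 Uz; apply/differentiable_continuous/derivable1_diffP.
  by have [] := dD z z0 Uz.
have inU z : z <= y -> U2 z.
  by case: kU2 => _ d _ _ _ zy; exact: d Uy.
have [||z _] := @MVT R D (fun=> 0) 0 y y0.
- by move=> z /[!in_itv]/= /andP[z0 /ltW zy]; apply: dD => //; exact: inU.
- apply: derivable_oo_LRcontinuous_within; split.
  + move=> z /[!in_itv]/= /andP[z0 /ltW zy].
    by have [] := dD z z0 (inU _ zy).
  + apply: cvgB.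
      rewrite phi0; apply: cvg_comp cphi _.
      by apply: (continuous_primitive kU1); case: kU1.
    apply: cvgMr; apply: cvg_at_right_filter.
    by apply: (continuous_primitive kU2); case: kU2.
  + apply: cvg_at_left_filter; exact: cD.
- rewrite mul0r /D phi0 /P1 /P2 !set_itv1 !Rintegral_set1 mulr0 !subr0.
  by move=> /eqP; rewrite subr_eq0 => /eqP.
Qed.

End substitution.

(** * Improper integrals as suprema *)

Section improper_integral.
Context {R : realType}.
Notation mu := (@lebesgue_measure R).

(** Monotone convergence along [[0, v n]], where [v n = b (1 - 1/(n+1))] increases to [b], gives one
    inequality; positivity of [k] gives the other. Both sides may be [+oo]. *)
Lemma integral_itvco_ereal_sup (k : R -> R) (b : R) :
  integrand_on k `]-oo, b[ ->
  (\int[mu]_(t in `[0%R, b[) (k t)%:E =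
   ereal_sup [set (\int[mu]_(t in `[0%R, y]) k t)%:E | y in `[0%R, b[])%E.
Proof.
move=> kU; have [_ _ U0 _ k0] := kU.
have b0 : 0 < b by move: U0; rewrite /= in_itv.
have kge0 (t : R) : t < b -> (0 <= (k t)%:E)%E.
  by move=> tb; rewrite lee_fin ltW// k0//= in_itv.
pose v (n : nat) : R := b * (1 - n.+1%:R^-1).
have vb n : v n < b by rewrite /v gtr_pMr// gtrBl.
have v0 n : 0 <= v n.
  by rewrite /v mulr_ge0 ?(ltW b0)// subr_ge0 invf_le1// ler1n.
have ik (y : R) : y < b -> mu.-integrable `[0, y] (EFin \o k).
  by move=> yb; apply: (integrable_primitive kU); rewrite /= in_itv.
have fint (y : R) : y < b -> ((\int[mu]_(t in `[0%R, y]) k t)%:E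
    = \int[mu]_(t in `[0%R, y]) (k t)%:E)%E.
  move=> yb; rewrite /Rintegral fineK//; apply: integrable_fin_num => //.
  exact: ik.
have nd : nondecreasing_seq (fun n => `[0%R, v n]%classic).
  move=> m n mn; rewrite subsetEset; apply: subset_itvl; rewrite bnd_simp.
  by rewrite /v ler_pM2l// lerB// lef_pV2 ?posrE// ler_nat.
have cupE : \bigcup_n `[0%R, v n]%classic = `[0%R, b[%classic.
  apply/seteqP; split => [t [n _]/=|t /=]; rewrite !in_itv/=.
    by move=> /andP[-> /le_lt_trans]; apply.
  move=> /andP[t0 tb].
  (* The condition [t <= v n] amounts to [1/(n+1) <= 1 - t/b], which holds for large [n]. *)
  have e0 : 0 < 1 - t / b by rewrite subr_gt0 ltr_pdivrMr// mul1r.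
  have [n _ nE] := near_infty_natSinv_lt (PosNum e0).
  exists n => //=; rewrite in_itv/= t0/= /v mulrC -ler_pdivrMr//.
  by rewrite lerBrDl -lerBrDr; have /= := nE n (leqnn n); exact: ltW.
apply/eqP; rewrite eq_le; apply/andP; split.
- have := @ge0_nondecreasing_set_cvg_integral _ (measurableTypeR R) R
    (fun n => `[0, v n]%classic) (EFin \o k) mu nd.
  rewrite cupE => H; apply: cvge_to_le (H _ _ _) _ => //.
  + by move=> n; exact: measurable_int (ik _ (vb n)).
  + by move=> n t; rewrite /= in_itv/= => /andP[_ /le_lt_trans] /(_ _ (vb n))/kge0.
  + near=> n; apply: ereal_sup_ubound => /=; exists (v n); last exact: fint.
    by rewrite in_itv/= v0 vb.
- apply: ge_ereal_sup => _ [y /= + <-]; rewrite in_itv/= => /andP[y0 yb].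
  rewrite fint//; apply: ge0_subset_integral => //.
  + rewrite -cupE; apply/measurable_fun_bigcup => // n.
    exact: measurable_int (ik _ (vb n)).
  + by move=> t; rewrite /= in_itv/= => /andP[_ /kge0].
  + by apply: subset_itvl; rewrite bnd_simp.
Unshelve. all: by end_near. Qed.

End improper_integral.

(** * The integrands of the generalized sine and hyperbolic sine *)

Section integrands.
Context {R : realType}.
Notation mu := (@lebesgue_measure R).
Implicit Types (p q s t x y : R).

Lemma continuous_powR (a x : R) : 0 < x -> {for x, continuous (@powR R ^~ a)}.
Proof.
move=> x0; apply/differentiable_continuous/derivable1_diffP.
by have [] := is_derive1_powR a x0.
Qed.

(* Since [t `^ q = 1] for [t < 0], the integrands jump at 0; replacing [t] by
   [max 0 t] removes the jump. *)
Definition pos_powR q t := (Num.max 0 t) `^ q.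

Lemma pos_powRE q t : 0 <= t -> pos_powR q t = t `^ q.
Proof. by move=> t0; rewrite /pos_powR max_r. Qed.

Lemma continuous_pos_powR q : 0 < q -> continuous (pos_powR q).
Proof.
move=> q0 x; case: (ltgtP x 0) => [x0|x0|->].
- have c0 : (fun=> 0 : R) @ x --> (0 : R) by exact: cvg_cst.
  rewrite /continuous_at {2}/pos_powR max_l ?(ltW x0)// powR0 ?gt_eqF//.
  apply: cvg_trans c0; apply: near_eq_cvg; near=> t.
  rewrite /pos_powR max_l ?powR0 ?gt_eqF//.
  by apply/ltW; near: t; exact: lt_nbhsl.
- rewrite /continuous_at pos_powRE ?(ltW x0)//.
  apply: cvg_trans (continuous_powR (a := q) x0).
  apply: near_eq_cvg; near=> t; rewrite pos_powRE//.
  by apply/ltW; near: t; exact: lt_nbhsr.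
- apply/left_right_continuousP; rewrite pos_powRE// powR0 ?gt_eqF//.
  split; last first.
    apply: cvg_trans (powR_cvg0 q0).
    by apply: near_eq_cvg; near=> t; rewrite pos_powRE.
  have c0 : (fun=> 0 : R) @ (0 : R)^'- --> (0 : R) by exact: cvg_cst.
  apply: cvg_trans c0; apply: near_eq_cvg; near=> t.
  by rewrite /pos_powR max_l ?powR0 ?gt_eqF.
Unshelve. all: by end_near. Qed.

(** On nonnegative [t], the sign [s = -1] gives the integrand of [Fint] and [s = 1] that of
    [Gint]. *)
Definition pq_integrand s p q t := ((1 + s * pos_powR q t) `^ p^-1)^-1.

Lemma continuous_pq_integrand s p q t : 0 < q -> 0 < 1 + s * pos_powR q t ->
  {for t, continuous (pq_integrand s p q)}.
Proof.
move=> q0 h; apply: cvgV; first by rewrite gt_eqF// powR_gt0.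
apply: (@continuous_comp _ _ _ (fun t => 1 + s * pos_powR q t)
  (fun x => x `^ p^-1)); last exact: continuous_powR.
by apply: cvgD; [exact: cvg_cst|apply: cvgMr; exact: continuous_pos_powR].
Qed.

Lemma pq_integrand_gt0 s p q t : 0 < 1 + s * pos_powR q t ->
  0 < pq_integrand s p q t.
Proof. by move=> h; rewrite invr_gt0 powR_gt0. Qed.

Lemma powR_lt1 q t : 0 < q -> 0 <= t -> t < 1 -> t `^ q < 1.
Proof.
move=> q0 t0 t1; have := gt0_ltr_powR q0 _ _ t1.
by rewrite !nnegrE powR1; apply.
Qed.

Lemma sin_integrand_on p q : 0 < q ->
  integrand_on (pq_integrand (-1) p q) `]-oo, 1[.
Proof.
move=> q0.
have pos x : (`]-oo, 1[%classic : set R) x -> 0 < 1 + (-1) * pos_powR q x.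
  rewrite /= in_itv/= => x1; rewrite mulN1r subr_gt0 powR_lt1//.
    by rewrite le_max lexx.
  by rewrite gt_max ltr01.
split => [|x y xy||x /pos|x /pos].
- exact: interval_open.
- by rewrite /= !in_itv/=; exact: le_lt_trans.
- by rewrite /= in_itv/=.
- exact: continuous_pq_integrand.
- exact: pq_integrand_gt0.
Qed.

Lemma sinh_integrand_on p q : 0 < q ->
  integrand_on (pq_integrand 1 p q) [set: R].
Proof.
move=> q0.
have pos x : 0 < 1 + 1 * pos_powR q x by rewrite mul1r ltr_pwDl// powR_ge0.
split => // [|x _|x _].
- exact: openT.
- exact: continuous_pq_integrand.
- exact: pq_integrand_gt0.
Qed.

Lemma pq_integrandE s p q t : 0 <= t ->
  pq_integrand s p q t = ((1 + s * t `^ q) `^ p^-1)^-1.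
Proof. by move=> t0; rewrite /pq_integrand pos_powRE. Qed.

Lemma FintE p q y : Fint p q y = \int[mu]_(t in `[0, y]) pq_integrand (-1) p q t.
Proof.
apply: eq_Rintegral => t; rewrite inE/= in_itv/= => /andP[t0 _].
by rewrite pq_integrandE// mulN1r.
Qed.

Lemma GintE p q y : Gint p q y = \int[mu]_(t in `[0, y]) pq_integrand 1 p q t.
Proof.
apply: eq_Rintegral => t; rewrite inE/= in_itv/= => /andP[t0 _].
by rewrite pq_integrandE// mul1r.
Qed.

(** Together with [cospqE], this turns an identity at the argument [Fint p q y] into an algebraic
    one in [y]; [sinhpqK] and [coshpqE] do the same for [Gint]. *)
Lemma sinpqK p q y : 0 < q -> 0 <= y < 1 -> sinpq p q (Fint p q y) = y.
Proof.
move=> q0 /andP[y0 y1]; rewrite /sinpq (funext (FintE p q)).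
apply: (primitiveK (sin_integrand_on p q0)) => //=.
by apply/seteqP; split => z /=; rewrite !in_itv/= => /andP.
Qed.

Lemma cospqE p q y : 0 < q -> 0 <= y < 1 ->
  cospq p q (Fint p q y) = (1 - y `^ q) `^ p^-1.
Proof.
move=> q0 /andP[y0 y1]; rewrite /cospq /sinpq (funext (FintE p q)).
rewrite (deriv_from0_inv (sin_integrand_on p q0)) //=.
  by rewrite pq_integrandE// mulN1r invrK.
by apply/seteqP; split => z /=; rewrite !in_itv/= => /andP.
Qed.

Lemma sinhpqK p q y : 0 < q -> 0 <= y -> sinhpq p q (Gint p q y) = y.
Proof.
move=> q0 y0; rewrite /sinhpq (funext (GintE p q)).
apply: (primitiveK (sinh_integrand_on p q0)) => //=.
by apply/seteqP; split => z /=; rewrite !in_itv/= andbT // => -[].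
Qed.

Lemma coshpqE p q y : 0 < q -> 0 <= y ->
  coshpq p q (Gint p q y) = (1 + y `^ q) `^ p^-1.
Proof.
move=> q0 y0; rewrite /coshpq /sinhpq (funext (GintE p q)).
rewrite (deriv_from0_inv (sinh_integrand_on p q0)) //=.
  by rewrite pq_integrandE// mul1r invrK.
by apply/seteqP; split => z /=; rewrite !in_itv/= andbT // => -[].
Qed.

(** A supremum in the extended reals treats finite and infinite values of pi alike. *)
Lemma pipqE p q : 0 < q ->
  (pipq p q = 2%:E * ereal_sup [set (Fint p q y)%:E | y in `[0%R, 1%R[])%E.
Proof.
move=> q0; rewrite /pipq; congr (_ * _)%E.
rewrite (funext (FintE p q)) -(integral_itvco_ereal_sup (sin_integrand_on p q0)).
apply: eq_integral => t; rewrite inE/= in_itv/= => /andP[t0 _].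
by rewrite pq_integrandE// mulN1r.
Qed.

Lemma Fint_IVT p q x y : 0 < q -> 0 <= y < 1 -> 0 <= x <= Fint p q y ->
  exists z, 0 <= z < 1 /\ Fint p q z = x.
Proof.
move=> q0 /andP[y0 y1]; rewrite (funext (FintE p q)) => xy.
have [|z []] := primitive_IVT (sin_integrand_on p q0) y0 _ xy.
  by rewrite /= in_itv.
by rewrite /= in_itv/= => z0 z1; exists z; rewrite z0 z1.
Qed.

End integrands.

(** * The three power substitutions *)

Section power_substitution.
Context {R : realType}.
Implicit Types (a b c e p q x y z : R).

(* phi, psi and theta are the cases (c, b) = (2^(2/q), 1/q), (2^(2/q), -2/q) and
   (1, -1/q). *)
Definition power_subst c b q z := c * (z * (1 + z `^ q) `^ b).

Lemma power_subst_at0 c b q : power_subst c b q 0 = 0.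
Proof. by rewrite /power_subst mul0r mulr0. Qed.

Lemma power_subst_ge0 c b q z : 0 <= c -> 0 <= z -> 0 <= power_subst c b q z.
Proof. by move=> c0 z0; rewrite !mulr_ge0 ?powR_ge0. Qed.

Lemma power_subst_gt0 c b q z : 0 < c -> 0 < z -> 0 < power_subst c b q z.
Proof.
by move=> c0 z0; rewrite !mulr_gt0 ?powR_gt0// ltr_pwDl ?powR_ge0.
Qed.

Lemma power_subst_cvg0 c b q : 0 < q ->
  power_subst c b q z @[z --> 0^'+] --> 0.
Proof.
move=> q0; rewrite -[X in _ --> X](mulr0 c); apply: cvgMr.
rewrite -[X in _ --> X](mul0r ((1 + 0) `^ b)); apply: cvgM.
  exact: cvg_at_right_filter cvg_id.
have H : (1 + z `^ q) @[z --> 0^'+] --> (1 + 0 : R).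
  by apply: cvgD; [exact: cvg_cst|exact: powR_cvg0].
have K : {for 1 + 0 : R, continuous (@powR R ^~ b)}.
  by apply: continuous_powR; rewrite addr0.
exact: (cvg_comp _ _ H K).
Qed.

Lemma powR_pred x a : 0 < x -> x `^ a = x * x `^ (a - 1).
Proof.
move=> x0; rewrite powRB; last by rewrite (gt_eqF x0) implybT.
by rewrite powRr1 ?ltW// mulrC divfK// gt_eqF.
Qed.

(** The last factor is arranged to simplify: with [u = z^q], it is [1 + 2u], [1 - u] or [1]
    according as [b q] is [1], [-2] or [-1]. *)
Lemma is_derive_power_subst c b q z : 0 < z ->
  is_derive z (1 : R) (power_subst c b q)
    (c * ((1 + z `^ q) `^ (b - 1) * (1 + (1 + b * q) * z `^ q))).
Proof.
move=> z0; pose A := 1 + z `^ q.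
have A0 : 0 < A by rewrite ltr_pwDl ?powR_ge0.
have h1 : is_derive z (1 : R) (fun z => 1 + z `^ q) (0 + q * z `^ (q - 1)).
  exact: is_deriveD (is_derive_cst _ _ _) (is_derive1_powR q z0).
have h2 : is_derive z (1 : R) (fun z => (1 + z `^ q) `^ b)
    (b * A `^ (b - 1) * (0 + q * z `^ (q - 1))).
  exact: (@is_derive1_comp R (@powR R ^~ b) (fun z => 1 + z `^ q) _ _ _
    (is_derive1_powR b A0) h1).
have h3 := is_deriveM (is_derive_id z (1 : R)) h2.
have h4 := is_deriveZ c h3.
apply: is_derive_eq h4 _; rewrite [LHS]/GRing.scale/=; congr (c * _).
rewrite /GRing.scale/= -/A add0r mulr1.
(* One factor is split off each power, so that only [A^(b-1)] and [z^(q-1)] remain and the identity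
   is polynomial. *)
rewrite (powR_pred b A0); move: (A `^ (b - 1)) => B; rewrite /A (powR_pred q z0).
by ring.
Qed.

Lemma power_substX c b q z : q != 0 -> 0 <= c -> 0 <= z ->
  power_subst c b q z `^ q = c `^ q * (z `^ q * (1 + z `^ q) `^ (b * q)).
Proof.
move=> q0 c0 z0; have A0 : 0 <= 1 + z `^ q by rewrite addr_ge0 ?powR_ge0.
by rewrite !powRM ?mulr_ge0 ?powR_ge0// -powRrM.
Qed.

Lemma powR_addr x a b : 0 < x -> x `^ a * x `^ b = x `^ (a + b).
Proof. by move=> x0; rewrite powRD// (gt_eqF x0) implybT. Qed.

Lemma powRVr x a : 0 < x -> x^-1 `^ a = x `^ (- a).
Proof.
by move=> x0; rewrite -powR_inv1 ?ltW// -powRrM mulN1r.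
Qed.

Lemma sqr_powR_half x : 0 <= x -> (x ^+ 2) `^ 2^-1 = x.
Proof. by move=> x0; rewrite powR12_sqrt ?sqr_ge0// sqrtr_sqr ger0_norm. Qed.

Lemma powR_sqr x a : 0 <= x -> (x ^+ 2) `^ a = x `^ (2 * a).
Proof. by move=> x0; rewrite -powR_mulrn// -powRrM. Qed.

Variable q : R.
Hypothesis q_gt1 : 1 < q.
Let q_gt0 : 0 < q. Proof. exact: lt_trans q_gt1. Qed.

(** The value is dictated by [c^q = 4], which completes two squares: [1 + 4u(1+u) = (1+2u)^2] and
    [1 - 4u/(1+u)^2 = ((1-u)/(1+u))^2]. *)
Let c : R := 2 `^ (2 / q).
Let c_gt0 : 0 < c. Proof. by rewrite powR_gt0. Qed.
Let cX : c `^ q = 4.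
Proof.
by rewrite /c -powRrM divfK ?gt_eqF// powR_mulrn// -natrX.
Qed.

Lemma sinh_substX y : 0 <= y ->
  1 + power_subst c q^-1 q y `^ q = (1 + 2 * y `^ q) ^+ 2.
Proof.
move=> y0; have A0 : 0 <= 1 + y `^ q by rewrite addr_ge0 ?powR_ge0.
rewrite power_substX ?gt_eqF ?(ltW c_gt0)// cX mulVf ?gt_eqF// powRr1//.
by ring.
Qed.

Lemma sin_substX y : 0 <= y ->
  1 - power_subst c (- (2 / q)) q y `^ q =
  ((1 - y `^ q) / (1 + y `^ q)) ^+ 2.
Proof.
move=> y0; have A0 : 0 < 1 + y `^ q by rewrite ltr_pwDl ?powR_ge0.
rewrite power_substX ?gt_eqF ?(ltW c_gt0)// cX mulNr divfK ?gt_eqF//.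
rewrite powR_invn ?(ltW A0)//; field.
by rewrite gt_eqF.
Qed.

Lemma sin_sinh_substX y : 0 <= y ->
  1 - power_subst 1 (- q^-1) q y `^ q = (1 + y `^ q)^-1.
Proof.
move=> y0; have A0 : 0 < 1 + y `^ q by rewrite ltr_pwDl ?powR_ge0.
rewrite power_substX ?gt_eqF// powR1 mul1r mulNr mulVf ?gt_eqF//.
rewrite powR_inv1 ?(ltW A0)//; field.
by rewrite gt_eqF.
Qed.

(** With [u = z^q], the integrand becomes [1/(1+2u)] and cancels the same factor of the derivative.
    What remains is [c (1+u)^(1/q-1)], and [1 - 1/q] is the reciprocal of [q/(q-1)]. *)
Lemma Gint_subst y : 0 <= y ->
  Gint 2 q (power_subst c q^-1 q y) = c * Gint (q / (q - 1)) q y.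
Proof.
move=> y0; rewrite !GintE.
apply: (@primitive_substitution R _ _ setT setT (power_subst c q^-1 q) _ c y
  (sinh_integrand_on 2 q_gt0) (sinh_integrand_on (q / (q - 1)) q_gt0)) => //.
- exact: power_subst_at0.
- exact: power_subst_cvg0.
- move=> z z0 _; split => //; first exact: power_subst_gt0.
    exact: is_derive_power_subst.
  have u0 : 0 < z `^ q by rewrite powR_gt0.
  have A0 : 0 < 1 + z `^ q by rewrite addr_gt0.
  rewrite !pq_integrandE ?power_subst_ge0 ?(ltW z0) ?(ltW c_gt0)//.
  rewrite !mul1r sinh_substX ?(ltW z0)// sqr_powR_half; last by lra.
  rewrite mulVf ?gt_eqF// -powRN.
  have -> : - (q / (q - 1))^-1 = q^-1 - 1.
    by field; rewrite !gt_eqF ?subr_gt0.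
  by field; rewrite gt_eqF//; lra.
Qed.

Lemma lt1_of_powR x : 0 <= x -> 0 < 1 - x `^ q -> x < 1.
Proof.
move=> x0; rewrite subr_gt0; apply: contraTT; rewrite -!leNgt => x1.
have := ge0_ler_powR (ltW q_gt0) _ _ x1.
by rewrite !nnegrE powR1; exact.
Qed.

Lemma sin_subst_lt1 y : 0 <= y -> y < 1 -> power_subst c (- (2 / q)) q y < 1.
Proof.
move=> y0 y1; have u1 := powR_lt1 q_gt0 y0 y1.
apply: lt1_of_powR; first exact: power_subst_ge0 (ltW c_gt0) y0.
rewrite sin_substX// exprn_gt0//.
by rewrite divr_gt0 ?subr_gt0// ltr_pwDl ?powR_ge0.
Qed.

Lemma sin_sinh_subst_lt1 y : 0 <= y -> power_subst 1 (- q^-1) q y < 1.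
Proof.
move=> y0; apply: lt1_of_powR; first exact: power_subst_ge0 y0.
by rewrite sin_sinh_substX// invr_gt0 ltr_pwDl ?powR_ge0.
Qed.

(** The integrand becomes [((1+u)/(1-u))^(1+2/q)]. Multiplied by the derivative
    [c (1+u)^(-2/q-1) (1-u)], it leaves [c (1-u)^(-2/q)]. *)
Lemma Fint_subst y : 0 <= y < 1 ->
  Fint (2 * q / (q + 2)) q (power_subst c (- (2 / q)) q y) = c * Fint (q / 2) q y.
Proof.
move=> /andP[y0 y1]; rewrite !FintE.
apply: (@primitive_substitution R _ _ _ _ (power_subst c (- (2 / q)) q) _ c y
  (sin_integrand_on (2 * q / (q + 2)) q_gt0) (sin_integrand_on (q / 2) q_gt0)) => //.
- exact: power_subst_at0.
- exact: power_subst_cvg0.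
- move=> z z0; rewrite /= !in_itv/= => z1; split => //.
  + exact: power_subst_gt0.
  + exact: sin_subst_lt1 (ltW z0) z1.
  + exact: is_derive_power_subst.
  have u0 : 0 < z `^ q by rewrite powR_gt0.
  have u1 := powR_lt1 q_gt0 (ltW z0) z1.
  have A0 : 0 < 1 + z `^ q by rewrite addr_gt0.
  have B0 : 0 < 1 - z `^ q by rewrite subr_gt0.
  rewrite !pq_integrandE ?power_subst_ge0 ?(ltW z0) ?(ltW c_gt0)//.
  rewrite !mulN1r sin_substX ?(ltW z0)// powR_sqr ?divr_ge0 ?(ltW A0) ?(ltW B0)//.
  rewrite powRM ?invr_ge0 ?(ltW A0) ?(ltW B0)// powRVr//.
  have -> : 2 * (2 * q / (q + 2))^-1 = 1 + 2 / q.
    by field; rewrite !gt_eqF// addr_gt0.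
  have -> : - (2 / q) - 1 = - (1 + 2 / q) by ring.
  have -> : (q / 2)^-1 = 2 / q by field; rewrite gt_eqF.
  rewrite !powRN -(powR_addr 1 _ B0) (powRr1 (ltW B0)).
  by field; rewrite !gt_eqF ?powR_gt0.
Qed.

(** The integrand becomes [(1+u)^(2/q)] and the derivative is [(1+u)^(-1/q-1)]; their product is
    [(1+u)^(1/q-1)]. *)
Lemma Fint_Gint_subst y : 0 <= y ->
  Fint (q / 2) q (power_subst 1 (- q^-1) q y) = Gint (q / (q - 1)) q y.
Proof.
move=> y0; rewrite FintE GintE -[RHS]mul1r.
apply: (@primitive_substitution R _ _ _ setT (power_subst 1 (- q^-1) q) _ 1 y
  (sin_integrand_on (q / 2) q_gt0) (sinh_integrand_on (q / (q - 1)) q_gt0)) => //.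
- exact: power_subst_at0.
- exact: power_subst_cvg0.
- move=> z z0 _.
  have u0 : 0 < z `^ q by rewrite powR_gt0.
  have A0 : 0 < 1 + z `^ q by rewrite addr_gt0.
  split => //; first exact: power_subst_gt0.
  + rewrite /= in_itv/=; exact: sin_sinh_subst_lt1 (ltW z0).
  + exact: is_derive_power_subst.
  rewrite !pq_integrandE ?power_subst_ge0 ?(ltW z0)//.
  rewrite mulN1r sin_sinh_substX ?(ltW z0)// powRVr// -!powRN !mul1r opprK.
  rewrite mulNr mulVf ?gt_eqF// subrr mul0r addr0 mulr1 powR_addr//.
  by congr powR; field; rewrite !gt_eqF ?subr_gt0.
Qed.

Lemma sin_subst_surj z : 0 <= z < 1 ->
  exists2 y, 0 <= y < 1 & power_subst c (- (2 / q)) q y = z.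
Proof.
move=> /andP[z0 z1]; have z1q := powR_lt1 q_gt0 z0 z1.
(* Solve [1 - z^q = w^2] with [w = (1 - y^q) / (1 + y^q)] for [y^q]. *)
pose w : R := Num.sqrt (1 - z `^ q).
have w0 : 0 < w by rewrite sqrtr_gt0 subr_gt0.
have w2 : w ^+ 2 = 1 - z `^ q by rewrite sqr_sqrtr// subr_ge0 ltW.
have w1 : w <= 1 by rewrite -(expr_le1 (n := 2)) ?(ltW w0)// w2 gerBl powR_ge0.
pose y := ((1 - w) / (1 + w)) `^ q^-1.
have y0 : 0 <= y by exact: powR_ge0.
have yq : y `^ q = (1 - w) / (1 + w).
  rewrite /y -powRrM mulVf ?gt_eqF// powRr1// divr_ge0 ?subr_ge0//.
  by rewrite addr_ge0 ?(ltW w0).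
exists y.
  rewrite y0 lt1_of_powR// yq; have -> : 1 - (1 - w) / (1 + w) = 2 * w / (1 + w).
    by field; rewrite gt_eqF// addr_gt0.
  by rewrite divr_gt0 ?mulr_gt0// addr_gt0.
(* Both sides are nonnegative, so their [q]-th powers may be compared, and these through
   [1 - z^q]. *)
apply: (powR_injective q_gt0); rewrite ?nnegrE ?power_subst_ge0 ?(ltW c_gt0)//.
apply: oppr_inj; apply: (addrI 1); rewrite sin_substX// yq -w2.
by field; apply/andP; split; rewrite gt_eqF//; lra.
Qed.

Lemma sin_sinh_subst_surj z : 0 <= z < 1 ->
  exists2 y, 0 <= y & power_subst 1 (- q^-1) q y = z.
Proof.
move=> /andP[z0 z1]; have z1q := powR_lt1 q_gt0 z0 z1.
have B0 : 0 < 1 - z `^ q by rewrite subr_gt0.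
(* The equation [z^q = u/(1+u)] has the solution [u = z^q/(1-z^q)], and [y] is its [q]-th root. *)
pose y := (z `^ q / (1 - z `^ q)) `^ q^-1.
have y0 : 0 <= y by exact: powR_ge0.
have yq : y `^ q = z `^ q / (1 - z `^ q).
  rewrite /y -powRrM mulVf ?gt_eqF// powRr1// divr_ge0 ?powR_ge0//.
  exact: ltW.
exists y => //.
apply: (powR_injective q_gt0); rewrite ?nnegrE ?power_subst_ge0//.
apply: oppr_inj; apply: (addrI 1); rewrite sin_sinh_substX// yq.
by field; apply/andP; split; rewrite gt_eqF//; lra.
Qed.

(** The substitution maps [[0, 1[] onto itself, so the two sets of values differ by the factor [c];
    scaling a supremum by a positive real is valid for infinite values too. *)
Lemma ereal_sup_Fint_subst :
  (ereal_sup [set (Fint (2 * q / (q + 2))%R q y)%:E | y in `[0%R, 1%R[] =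
   c%:E * ereal_sup [set (Fint (q / 2)%R q y)%:E | y in `[0%R, 1%R[])%E.
Proof.
rewrite -ereal_sup_pZl//; congr ereal_sup; apply/seteqP; split => e /=.
- move=> [z]; rewrite in_itv/= => /sin_subst_surj[y y01 <-] <-.
  exists (Fint (q / 2) q y)%:E; first by exists y => //; rewrite in_itv.
  by rewrite Fint_subst.
- move=> [_ [y + <-] <-]; rewrite in_itv/= => y01; have /andP[y0 y1] := y01.
  exists (power_subst c (- (2 / q)) q y); last by rewrite Fint_subst.
  by rewrite in_itv/= sin_subst_lt1// power_subst_ge0// ltW.
Qed.

Lemma half_pipq p :
  (pipq p q / 2%:E = ereal_sup [set (Fint p q y)%:E | y in `[0%R, 1%R[])%E.
Proof.
rewrite pipqE// inver pnatr_eq0/= muleC muleA -EFinM mulVf ?pnatr_eq0//.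
by rewrite mul1e.
Qed.

End power_substitution.

(** * Derivation of the identities from the substitutions *)

Theorem theorem1p6 (R : realType) (q qs : R) (hq : 1 < q)
    (hqs : qs = q / (q - 1)) :
  (pipq (2 * q / (q + 2))%R q / (2 `^ (2 / q + 1))%R%:E
     = pipq (q / 2)%R q / 2%:E)%E /\
  forall x : R, 0 <= x -> (x%:E < pipq (q / 2)%R q / 2%:E)%E ->
    [/\ sinhpq 2 q (2 `^ (2 / q) * x)
          = 2 `^ (2 / q) * sinhpq qs q x * coshpq qs q x `^ (qs - 1),
        coshpq 2 q (2 `^ (2 / q) * x)
          = coshpq qs q x `^ qs + sinhpq qs q x `^ q,
        sinpq (2 * q / (q + 2)) q (2 `^ (2 / q) * x)
          = 2 `^ (2 / q) * sinpq (q / 2) q x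
              / (1 + sinpq (q / 2) q x `^ q) `^ (2 / q)
      & cospq (2 * q / (q + 2)) q (2 `^ (2 / q) * x)
          = ((1 - sinpq (q / 2) q x `^ q) / (1 + sinpq (q / 2) q x `^ q))
              `^ (2 / q + 1)].
Proof.
have q0 : 0 < q := lt_trans ltr01 hq.
have qB1 : 0 < q - 1 by rewrite subr_gt0.
set c : R := 2 `^ (2 / q).
have c0 : 0 < c by rewrite powR_gt0.
split.
  rewrite [RHS](half_pipq hq) (pipqE _ q0) (ereal_sup_Fint_subst hq) -/c.
  (* The denominator is [2c]: its [c] cancels the factor between the suprema, its 2 the one in the
     definition of pi. *)
  rewrite -powR_addr// powRr1// -/c inver mulf_eq0 !gt_eqF//=.
  rewrite muleC !muleA -!EFinM.
  have -> : (c * 2)^-1 * 2 * c = 1 by field; rewrite gt_eqF.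
  by rewrite mul1e.
(* Below the supremum there is a value [Fint y' > x], so the intermediate value theorem applies on
   [[0, y']], even if pi is infinite. *)
move=> x x0; rewrite half_pipq// => /ereal_sup_gt[_ [y' /= + <-]].
rewrite in_itv/= lte_fin => y'01 xy'.
have [|y [y01 Fy]] := @Fint_IVT R (q / 2) q x y' q0 y'01.
  by rewrite x0 ltW.
(* The same [x] gets two parameters: [y] for the sine identities and [s] for the hyperbolic ones. *)
have [s s0 sy] := sin_sinh_subst_surj hq y01.
have Gs : Gint qs q s = x by rewrite hqs -Fint_Gint_subst// sy.
have /andP[y0 y1] := y01.
have A0 : 0 < 1 + s `^ q by rewrite ltr_pwDl ?powR_ge0.
have C0 : 0 < 1 + y `^ q by rewrite ltr_pwDl ?powR_ge0.
have B0 : 0 < 1 - y `^ q by rewrite subr_gt0 powR_lt1.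
have phi0 : 0 <= power_subst c q^-1 q s by rewrite power_subst_ge0// ltW.
have psi0 : 0 <= power_subst c (- (2 / q)) q y < 1.
  by rewrite power_subst_ge0 ?(ltW c0)//= sin_subst_lt1.
have qs0 : 0 < qs by rewrite hqs divr_gt0.
have sinh_cx : sinhpq 2 q (c * x) = power_subst c q^-1 q s.
  by rewrite -Gs hqs -(Gint_subst hq s0) sinhpqK.
have cosh_cx : coshpq 2 q (c * x) = 1 + 2 * s `^ q.
  rewrite -Gs hqs -(Gint_subst hq s0) (coshpqE _ q0 phi0) (sinh_substX hq s0).
  rewrite sqr_powR_half//.
  by rewrite addr_ge0// mulr_ge0 ?powR_ge0.
have sinh_x : sinhpq qs q x = s by rewrite -Gs sinhpqK.
have cosh_x : coshpq qs q x = (1 + s `^ q) `^ qs^-1 by rewrite -Gs coshpqE.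
have cxE : c * x = Fint (2 * q / (q + 2)) q (power_subst c (- (2 / q)) q y).
  by rewrite (Fint_subst hq y01) Fy.
have sin_cx : sinpq (2 * q / (q + 2)) q (c * x) = power_subst c (- (2 / q)) q y.
  rewrite cxE; exact: (sinpqK _ q0 psi0).
have cos_cx : cospq (2 * q / (q + 2)) q (c * x) =
    ((1 - y `^ q) / (1 + y `^ q)) `^ (2 / q + 1).
  rewrite cxE (cospqE _ q0 psi0) (sin_substX hq y0).
  rewrite powR_sqr; last first.
    by rewrite divr_ge0 ?ltW.
  by congr powR; field; rewrite !gt_eqF// addr_gt0.
have sin_x : sinpq (q / 2) q x = y by rewrite -Fy sinpqK.
rewrite sinh_cx cosh_cx sinh_x cosh_x sin_cx cos_cx sin_x -!powRrM.
split.
(* The exponents agree because [(qs - 1)/qs = 1/q]. *)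
- rewrite /power_subst mulrA; congr (_ * _ `^ _).
  by rewrite hqs; field; rewrite !gt_eqF.
- rewrite mulVf ?gt_eqF// powRr1 ?(ltW A0)//; ring.
- by rewrite /power_subst powRN mulrA.
- by [].
Qed.
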